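(* Let $0<a\le1/4$, $b>1$, $\delta>0$, let $u$ be the periodic 2-peakon solution of the Novikov equation on $\mathbb{T}$ with initial profile $-(b+\delta)\cosh([x+a]_p-\pi)+b\cosh([x-a]_p-\pi)$ and lifespan $T$ described in the context, and let $v_T(x)=w_T\cosh([x-q_T]_p-\pi)$. Then for every $s<5/4$, $$\lim_{t\to T^-}\|u(t)-v_T\|_{H^s(\mathbb{T})}=0.$$
   Context: $\mathbb{T}=\mathbb{R}/2\pi\mathbb{Z}$; $[x]_p=x-2\pi\lfloor x/(2\pi)\rfloor$; $E(x)=\frac{1}{\cosh\pi}\cosh([x]_p-\pi)$ and $E'(x)=\frac{1}{\cosh\pi}\sinh([x]_p-\pi)$. The 2-peakon is $u(x,t)=p_1(t)\cosh([x-q_1(t)]_p-\pi)+p_2(t)\cosh([x-q_2(t)]_p-\pi)$, where, with $q=q_2-q_1$, $(q_1,q_2,p_1,p_2)$ is the unique smooth solution of $q_1'=\cosh^2\pi\,(p_1+p_2E(q))^2$, $q_2'=\cosh^2\pi\,(p_1E(q)+p_2)^2$, $p_1'=\cosh^2\pi\,p_1p_2(p_1+p_2E(q))E'(q)$, $p_2'=-\cosh^2\pi\,p_1p_2(p_1E(q)+p_2)E'(q)$, with $q_1(0)=-a$, $q_2(0)=a$, $p_1(0)=-(b+\delta)$, $p_2(0)=b$, on the interval $[0,T)$, where $T<\infty$ is the lifespan: $q>0$ on $[0,T)$ and $q(t)\to0$ as $t\to T^-$. Further, $w_T=\lim_{t\to T^-}(p_1(t)+p_2(t))$ and $q_T=\lim_{t\to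 T^-}q_1(t)=\lim_{t\to T^-}q_2(t)$. The norm is $\|f\|_{H^s}^2=\sum_{n\in\mathbb{Z}}(1+n^2)^s|\widehat f(n)|^2$. *)

(* Defs.v *)
From mathcomp Require Import all_boot all_order all_algebra.
From mathcomp Require Import all_classical all_reals all_analysis.
From mathcomp Require Import complex.
Set Implicit Arguments.
Unset Strict Implicit.
Unset Printing Implicit Defensive.
Import Order.TTheory GRing.Theory Num.Theory.
Import numFieldNormedType.Exports.
Local Open Scope classical_set_scope.
Local Open Scope ring_scope.

Definition cosh (R : realType) (x : R) : R := (expR x + expR (- x)) / 2.

Definition sinh (R : realType) (x : R) : R := (expR x - expR (- x)) / 2.

(* The representative of x modulo 2 pi in [0, 2 pi[. *)
Definition per (R : realType) (x : R) : R :=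
  x - 2 * pi * (Num.floor (x / (2 * pi)))%:~R.

(* Functions on the circle are represented by 2 pi-periodic functions on R. *)
Definition peakon (R : realType) (q x : R) : R := cosh (per (x - q) - pi).

Definition Efun (R : realType) (x : R) : R := (cosh pi)^-1 * cosh (per x - pi).

(* The derivative of Efun away from 2 pi Z; at the points of 2 pi Z, where Efun
   has a corner, this is its right derivative. *)
Definition dEfun (R : realType) (x : R) : R := (cosh pi)^-1 * sinh (per x - pi).

(* The derivative of f at t relative to A is l: the two-sided derivative at
   interior points of A, the one-sided derivative at endpoints. *)
Definition is_derive_in (R : realType) (A : set R) (f : R -> R) (t l : R) :
    Prop :=
  (f y - f t) / (y - t) @[y --> within A t^'] --> l.

(* A solution on [0, T[ of the 2-peakon system started from an
   antipeakon-peakon pair at (-a, a) with amplitudes (-(b + delta), b), which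
   exists exactly until the collision q2 - q1 --> 0 at the time T. *)
Record peakon_antipeakon (R : realType) (a b delta T : R)
    (q1 q2 p1 p2 : R -> R) : Prop := PeakonAntipeakon {
  pa_T_gt0 : 0 < T ;
  pa_q1_0 : q1 0 = - a ;
  pa_q2_0 : q2 0 = a ;
  pa_p1_0 : p1 0 = - (b + delta) ;
  pa_p2_0 : p2 0 = b ;
  pa_dq1 : forall t : R, 0 <= t < T ->
    is_derive_in `[0, T[ q1 t
      (cosh pi ^+ 2 * (p1 t + p2 t * Efun (q2 t - q1 t)) ^+ 2) ;
  pa_dq2 : forall t : R, 0 <= t < T ->
    is_derive_in `[0, T[ q2 t
      (cosh pi ^+ 2 * (p1 t * Efun (q2 t - q1 t) + p2 t) ^+ 2) ;
  pa_dp1 : forall t : R, 0 <= t < T ->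
    is_derive_in `[0, T[ p1 t
      (cosh pi ^+ 2 * p1 t * p2 t * (p1 t + p2 t * Efun (q2 t - q1 t))
         * dEfun (q2 t - q1 t)) ;
  pa_dp2 : forall t : R, 0 <= t < T ->
    is_derive_in `[0, T[ p2 t
      (- (cosh pi ^+ 2 * p1 t * p2 t * (p1 t * Efun (q2 t - q1 t) + p2 t)
         * dEfun (q2 t - q1 t))) ;
  pa_q_gt0 : forall t : R, 0 <= t < T -> 0 < q2 t - q1 t ;
  pa_collision : q2 t - q1 t @[t --> T^'-] --> (0 : R)
}.

Definition two_peakon (R : realType) (q1 q2 p1 p2 : R -> R) (t x : R) : R :=
  p1 t * peakon (q1 t) x + p2 t * peakon (q2 t) x.

(* (2 pi)^-1 \int_0^(2 pi) f(x) e^(- i n x) dx, split into its real and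
   imaginary parts. *)
Definition fourier_coef (R : realType) (f : R -> R) (n : int) : R[i] :=
  Complex
    ((2 * pi)^-1 *
       (\int[lebesgue_measure]_(x in `[0, 2 * pi]) (f x * cos (n%:~R * x))))
    (- ((2 * pi)^-1 *
       (\int[lebesgue_measure]_(x in `[0, 2 * pi]) (f x * sin (n%:~R * x))))).

(* The norm is +oo when the series diverges. *)
Definition sobolev_norm (R : realType) (s : R) (f : R -> R) : \bar R :=
  sqrte (\esum_(n in [set: int])
    ((1 + n%:~R ^+ 2) `^ s * Normc.normc (fourier_coef f n) ^+ 2)%:E).

(* Main.v *)
(* Two quantities are conserved, namely
     H = p1^2 + p2^2 + 2 p1 p2 E(q)  and  M = (p1 p2)^2 (1 - E(q)^2).
   Since 1 - E(q) is of exact order q as q --> 0, the second gives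
   |p1 p2| = O(q^(-1/2)), and then the first gives p1^2 + p2^2 = O(q^(-1/2)).
   With these rates q1' and p1' + p2' stay bounded, so that q_T and w_T exist.
   The n-th Fourier coefficient of cosh([x - r]_p - pi) is
   sinh(pi) / (pi (1 + n^2)) e^(- i n r), hence that of u(t) - v_T is
   sinh(pi) / (pi (1 + n^2)) times
     (p1 + p2 - w_T) e^(- i n q1) + p2 (e^(- i n q2) - e^(- i n q1))
       - w_T (e^(- i n q_T) - e^(- i n q1)).
   Interpolating |e^(i n x) - e^(i n y)|^2 <= C (n^2 (x - y)^2)^theta gives
     ||u(t) - v_T||^2 <= K ((p1 + p2 - w_T)^2 + p2^2 q^(2 theta)
                            + w_T^2 |q_T - q1|^(2 theta))
   as long as s + theta < 3/2; the middle term is O(q^(2 theta - 1/2)), and a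
   theta > 1/4 is available exactly when s < 5/4. *)
Require Import Defs.
From mathcomp Require Import all_boot all_order all_algebra.
From mathcomp Require Import all_classical all_reals all_analysis.
From mathcomp Require Import complex ring lra.
Import Order.TTheory GRing.Theory Num.Theory.
Import numFieldNormedType.Exports.
Local Open Scope classical_set_scope.
Local Open Scope ring_scope.

(** * Summability of powers of 1 + n^2 over the integers *)

(** Mean value theorem on [[x, x + 1]]: the slope of y^(-tau) is smallest in absolute value at the
    right end. A telescoping sum thus replaces the integral test. *)
Lemma powRN_telescope (R : realType) (tau x : R) : 0 < tau -> 0 < x ->
  tau * (x + 1) `^ (- tau - 1) <= x `^ (- tau) - (x + 1) `^ (- tau).
Proof.
move=> tau0 x0.
have [|||c /andP[xc cx1] E] :=
  @MVT R (fun y => y `^ (- tau)) (fun y => - tau * y `^ (- tau - 1)) x (x + 1).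
- by rewrite ltrDl.
- by move=> y; rewrite in_itv/= => /andP[xy _]; apply: is_derive1_powR; lra.
- apply: derivable_within_continuous => y /[!in_itv]/= /andP[xy _].
  by apply: ex_derive; apply: is_derive1_powR; lra.
rewrite !bnd_simp in xc cx1.
rewrite -[leRHS]opprB E.
have -> : x + 1 - x = 1 by ring.
rewrite mulr1 mulNr opprK ler_pM2l//.
have -> : - tau - 1 = - (tau + 1) by ring.
rewrite !powRN lef_pV2 ?posrE ?powR_gt0//; try lra.
by apply: ge0_ler_powR; rewrite ?nnegrE; lra.
Qed.

(** Taking any [g] above 1 + n^2 lets the same bound serve the nonnegative integers and the negative
    ones, where the index is shifted by one. *)
Lemma esum_nat_japanese_lty (R : realType) (sigma : R) (g : nat -> R) :
  2^-1 < sigma -> (forall n, 1 + n%:R ^+ 2 <= g n) ->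
  (\esum_(n in [set: nat]) (g n `^ (- sigma))%:E < +oo)%E.
Proof.
move=> s2 gn.
pose tau := 2 * sigma - 1.
have tau0 : 0 < tau by rewrite /tau; lra.
pose h (n : nat) : R := n.+1%:R `^ (- tau).
(* The 5 comes from (n + 2)^2 <= 5 (1 + n^2), that is, (2 n - 1)^2 >= 0; the division by [tau]
   undoes the factor in [powRN_telescope]. *)
pose K : R := 5 `^ sigma / tau.
have K0 : 0 <= K by rewrite divr_ge0 ?powR_ge0// ltW.
have le_h n : g n `^ (- sigma) <= K * (h n - h n.+1).
  apply: (@le_trans _ _ (K * (tau * (n.+1%:R + 1) `^ (- tau - 1)))); last first.
    rewrite ler_wpM2l// /h -[in leRHS](natr1 n.+1).
    exact: powRN_telescope.
  rewrite /K mulrA divfK ?gt_eqF//.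
  have -> : - tau - 1 = 2 * - sigma by rewrite /tau; ring.
  rewrite powRrM powR_mulrn ?addr_ge0//.
  rewrite !powRN -[_ `^ sigma * _]invrK invfM invrK lef_pV2; last 2 first.
  - by rewrite posrE powR_gt0//; have := gn n; have := sqr_ge0 (n%:R : R); lra.
  - by rewrite posrE mulr_gt0 ?invr_gt0// powR_gt0// exprn_gt0// addr_gt0.
  rewrite mulrC ler_pdivrMr ?powR_gt0//.
  have gn0 : 0 <= g n by have := gn n; have := sqr_ge0 (n%:R : R); lra.
  rewrite -powRM//.
  apply: ge0_ler_powR; rewrite ?nnegrE; first lra.
  - by rewrite exprn_ge0// addr_ge0.
  - by lra.
  - rewrite -(natr1 n); have := gn n; have := sqr_ge0 (2 * n%:R - 1 : R).
    by rewrite !expr2; lra.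
rewrite -nneseries_esumT; last by move=> n; rewrite lee_fin powR_ge0.
apply: (@le_lt_trans _ _ (K * h 0)%:E); last by rewrite ltry.
apply: lime_le.
  by apply: is_cvg_nneseries => n _ _; rewrite lee_fin powR_ge0.
near=> N.
rewrite sumEFin lee_fin.
apply: (@le_trans _ _ (\sum_(0 <= k < N) K * (h k - h k.+1))).
  by apply: ler_sum => k _; exact: le_h.
rewrite -mulr_sumr ler_wpM2l//.
rewrite (eq_bigr (fun k => - (h k.+1 - h k))); last by move=> k _; rewrite opprB.
rewrite sumrN telescope_sumr// opprB gerBl; exact: powR_ge0.
Unshelve. all: by end_near. Qed.

Lemma esum_int_japanese_lty (R : realType) (sigma : R) : 2^-1 < sigma ->
  (\esum_(n in [set: int]) ((1 + n%:~R ^+ 2) `^ (- sigma))%:E < +oo)%E.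
Proof.
move=> s2.
have ge0 (n : int) : (0 <= ((1 + n%:~R ^+ 2) `^ (- sigma))%:E :> \bar R)%E.
  by rewrite lee_fin powR_ge0.
rewrite (esumID (range Posz))//; apply: lte_add_pinfty.
- rewrite setTI (esum_image _ Posz)//.
  + exact: esum_nat_japanese_lty.
  + by move=> i j _ _ [].
- have -> : [set: int] `&` ~` range Posz = range Negz.
    rewrite setTI; apply/seteqP; split => [[n|n] /= nP|_ [n _ <-] [//]].
    + by exfalso; apply: nP; exists n.
    + by exists n.
  rewrite (esum_image _ Negz)//.
  + apply: esum_nat_japanese_lty => // n.
    rewrite NegzE mulrNz sqrrN lerD2l -pmulrn -(natr1 n).
    by have : 0 <= (n%:R : R) by []; move: (n%:R : R) => x; nra.
  + by move=> i j _ _ [].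
Qed.

(** * Differentiation rules and hyperbolic functions *)

Lemma derD (R : realType) (f g : R -> R) (x a b : R) :
  is_derive x 1 f a -> is_derive x 1 g b ->
  is_derive x 1 (fun y => f y + g y) (a + b).
Proof. exact: is_deriveD. Qed.

Lemma derN (R : realType) (f : R -> R) (x a : R) :
  is_derive x 1 f a -> is_derive x 1 (fun y => - f y) (- a).
Proof. exact: is_deriveN. Qed.

Lemma derM (R : realType) (f g : R -> R) (x a b : R) :
  is_derive x 1 f a -> is_derive x 1 g b ->
  is_derive x 1 (fun y => f y * g y) (a * g x + f x * b).
Proof.
move=> fa gb; apply: (is_derive_eq (is_deriveM fa gb)).
by rewrite addrC; congr (_ + _); rewrite mulrC.
Qed.

Lemma derZ (R : realType) (k : R) (f : R -> R) (x a : R) :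
  is_derive x 1 f a -> is_derive x 1 (fun y => k * f y) (k * a).
Proof. exact: is_deriveZ. Qed.

Lemma der_comp (R : realType) (f g : R -> R) (x a b : R) :
  is_derive (g x) 1 f a -> is_derive x 1 g b ->
  is_derive x 1 (fun y => f (g y)) (a * b).
Proof. exact: is_derive1_comp. Qed.

Lemma der_cosh (R : realType) (x : R) : is_derive x 1 (@cosh R) (sinh x).
Proof.
have H : is_derive x 1 (fun y : R => 2^-1 * (expR y + expR (- y)))
    (2^-1 * (expR x + expR (- x) * -1)).
  by apply: derZ; apply: derD.
apply: (@is_derive_eq _ _ _ _ _ _ _ (2^-1 * (expR x + expR (- x) * -1))).
  by congr (is_derive _ _ _ _): H; apply/funext => y; rewrite mulrC.
by rewrite /sinh mulrC mulrN1.
Qed.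

Lemma der_sinh (R : realType) (x : R) : is_derive x 1 (@sinh R) (cosh x).
Proof.
have H : is_derive x 1 (fun y : R => 2^-1 * (expR y - expR (- y)))
    (2^-1 * (expR x - expR (- x) * -1)).
  by apply: derZ; apply: derD.
apply: (@is_derive_eq _ _ _ _ _ _ _ (2^-1 * (expR x - expR (- x) * -1))).
  by congr (is_derive _ _ _ _): H; apply/funext => y; rewrite mulrC.
by rewrite /cosh mulrC mulrN1 opprK.
Qed.

Lemma der_shift (R : realType) (f : R -> R) (k x a : R) :
  is_derive (x + k) 1 f a -> is_derive x 1 (fun y => f (y + k)) a.
Proof.
move=> fa; apply: is_derive_eq (mulr1 a); apply: der_comp => //.
exact: is_derive_shift.
Qed.

Lemma der_scale (R : realType) (f : R -> R) (k x a : R) :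
  is_derive (k * x) 1 f a -> is_derive x 1 (fun y => f (k * y)) (a * k).
Proof.
move=> fa; apply: der_comp => //.
apply: is_derive_eq (mulr1 k); apply: derZ; exact: is_derive_id.
Qed.

Lemma cosh_continuous (R : realType) : continuous (@cosh R).
Proof.
move=> x; apply/differentiable_continuous/derivable1_diffP.
by case: (der_cosh _ x).
Qed.

Lemma coshN (R : realType) (x : R) : cosh (- x) = cosh x.
Proof. by rewrite /cosh opprK addrC. Qed.

Lemma sinhN (R : realType) (x : R) : sinh (- x) = - sinh x.
Proof. by rewrite /sinh opprK -mulNr opprB. Qed.

(** The case [a = b] is included because the corner of a peakon, at which integrals are split, may
    lie at the endpoint 0. *)
Lemma Rintegral_FTC2 (R : realType) (f F : R -> R) (a b : R) : a <= b ->
  (forall x : R, is_derive x 1 F (f x)) -> continuous f ->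
  (\int[lebesgue_measure]_(x in `[a, b]) f x)%R = F b - F a.
Proof.
move=> ab dF cf; have [eab|neab] := eqVneq a b.
  by rewrite eab set_itv1 Rintegral_set1 subrr.
have cF : continuous F.
  by move=> x; apply/differentiable_continuous/derivable1_diffP; case: (dF x).
rewrite /Rintegral (@continuous_FTC2 _ _ F)//.
- by rewrite lt_neqAle neab.
- exact: continuous_subspaceT.
- split.
  + by move=> x _; case: (dF x).
  + exact/cvg_at_right_filter/cF.
  + exact/cvg_at_left_filter/cF.
- by move=> x _; rewrite derive1E; case: (dF x).
Qed.

(** * Reduction modulo 2 pi *)

Lemma per_bound (R : realType) (x : R) : 0 <= per x < 2 * pi.
Proof.
have pi2 : 0 < 2 * pi :> R by rewrite mulr_gt0// pi_gt0.
have /andP[] := floor_itv (x / (2 * pi)).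
rewrite ler_pdivlMr// ltr_pdivrMr// intrD [(_%:~R + _) * _]mulrDl mul1r /per.
rewrite (mulrC (2 * pi)) => h1 h2.
by rewrite subr_ge0 h1/= ltrBlDl.
Qed.

Lemma perE (R : realType) (x y : R) (k : int) :
  x = y + 2 * pi * k%:~R -> 0 <= y < 2 * pi -> per x = y.
Proof.
move=> -> /andP[y0 y1]; have pi2 : 0 < 2 * pi :> R by rewrite mulr_gt0// pi_gt0.
suff -> : per (y + 2 * pi * k%:~R) = y + 2 * pi * k%:~R - 2 * pi * k%:~R.
  by rewrite addrK.
rewrite /per (@floor_def _ _ k)// ler_pdivlMr// ltr_pdivrMr// intrD.
rewrite [(_%:~R + _) * _]mulrDl mul1r.
by rewrite mulrC lerDr y0/= addrC ltrD2l.
Qed.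

Lemma per_id (R : realType) (x : R) : 0 <= x < 2 * pi -> per x = x.
Proof. by apply: (@perE _ _ _ 0); rewrite mulr0 addr0. Qed.

Lemma periodic_int (U V : zmodType) (f : U -> V) (T : U) : periodic f T ->
  forall (k : int) x, f (x + T *~ k) = f x.
Proof.
move=> fT [n|n] x; first exact: periodicn.
by rewrite NegzE mulrNz -[in RHS](subrK (T *+ n.+1) x) periodicn.
Qed.

Lemma cos_per (R : realType) (n : int) (x : R) :
  cos (n%:~R * per x) = cos (n%:~R * x).
Proof.
rewrite -[RHS](periodic_int _ _ _ _ (@cosD2pi R)
  (- (n * Num.floor (x / (2 * pi))))).
by congr cos; rewrite /per -[_ *+ 2 *~ _]mulrzr intrN intrM; ring.
Qed.

Lemma sin_per (R : realType) (n : int) (x : R) :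
  sin (n%:~R * per x) = sin (n%:~R * x).
Proof.
rewrite -[RHS](periodic_int _ _ _ _ (@sinD2pi R)
  (- (n * Num.floor (x / (2 * pi))))).
by congr sin; rewrite /per -[_ *+ 2 *~ _]mulrzr intrN intrM; ring.
Qed.

Lemma per_2pi (R : realType) : per (2 * pi : R) = 0.
Proof. by rewrite (@perE _ _ 0 1) ?mulr1 ?add0r// lexx/= mulr_gt0// pi_gt0. Qed.

Lemma cos_2pi_int (R : realType) (n : int) : cos (n%:~R * (2 * pi)) = 1 :> R.
Proof. by rewrite -cos_per per_2pi mulr0 cos0. Qed.

Lemma sin_2pi_int (R : realType) (n : int) : sin (n%:~R * (2 * pi)) = 0 :> R.
Proof. by rewrite -sin_per per_2pi mulr0 sin0. Qed.

(** * Fourier coefficients of peakons *)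

(** Where [x < per q] the reduction adds a full period, and the evenness of [cosh] turns the
    resulting x - per q + pi into the stated form. That form is visibly continuous in [x], which
    integrability rests on. *)
Lemma peakon_normE (R : realType) (q x : R) : 0 <= x <= 2 * pi ->
  peakon q x = cosh (`|x - per q| - pi).
Proof.
move=> /andP[x0 x1]; have /andP[r0 r1] := per_bound _ q.
pose k := Num.floor (q / (2 * pi)).
have qE : q = per q + 2 * pi * k%:~R by rewrite /per subrK.
rewrite /peakon; have [xr|rx] := ltP x (per q).
  rewrite (@perE _ _ (x - per q + 2 * pi) (- k - 1)); last 2 first.
  - by rewrite [in LHS]qE intrB intrN; ring.
  - by lra.
  rewrite ltr0_norm ?subr_lt0// -coshN; congr cosh; ring.
rewrite ger0_norm ?subr_ge0//.
(* At [x = 2 * pi] with [per q = 0] the difference x - per q is a full period and reduces to 0, so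
   this endpoint is handled apart. *)
have [/andP[]|] := boolP ((per q == 0) && (x == 2 * pi)).
  move=> /eqP r_0 /eqP x_2pi.
  rewrite (@perE _ _ 0 (- k + 1)); last 2 first.
  - by rewrite [in LHS]qE r_0 x_2pi intrD intrN; ring.
  - by rewrite lexx/= mulr_gt0// pi_gt0.
  by rewrite r_0 x_2pi -coshN; congr cosh; ring.
rewrite negb_and => h; rewrite (@perE _ _ (x - per q) (- k))//.
  by rewrite [in LHS]qE intrN; ring.
rewrite subr_ge0 rx/=; case/orP: h => h.
  have : 0 < per q by rewrite lt_neqAle eq_sym h.
  by lra.
have : x < 2 * pi by rewrite lt_neqAle h.
by lra.
Qed.

Lemma peakon_mul_continuous (R : realType) (q : R) (g : R -> R) : continuous g ->
  continuous (fun x => cosh (`|x - per q| - pi) * g x).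
Proof.
move=> cg x; apply: cvgM; last exact: cg.
apply: continuous_cvg; first exact: cosh_continuous.
apply: cvgB; last exact: cvg_cst.
by apply: cvg_norm; apply: cvgB; [exact: cvg_id|exact: cvg_cst].
Qed.

Lemma peakon_mul_integrable (R : realType) (q : R) (g : R -> R) : continuous g ->
  lebesgue_measure.-integrable `[0, 2 * pi] (EFin \o (fun x => peakon q x * g x)).
Proof.
move=> cg.
suff : lebesgue_measure.-integrable `[0, 2 * pi]
    (EFin \o (fun x => cosh (`|x - per q| - pi) * g x)).
  apply: eq_integrable => // x /[!inE]/=; rewrite in_itv/= => x02.
  by rewrite peakon_normE.
apply: continuous_compact_integrable; first exact: segment_compact.
exact/continuous_subspaceT/peakon_mul_continuous.
Qed.

(** Split at the corner [per q]: left of it the peakon is cosh (x + k) with k = pi - per q, right of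
    it with k = - pi - per q, so one family [F] of antiderivatives covers both sides. *)
Lemma Rintegral_peakon_mul (R : realType) (q : R) (g : R -> R) (F : R -> R -> R) :
  continuous g -> (forall k x : R, is_derive x 1 (F k) (cosh (x + k) * g x)) ->
  (\int[lebesgue_measure]_(x in `[0%R, (2 * pi)%R]) (peakon q x * g x))%R =
  F (pi - per q) (per q) - F (pi - per q) 0
    + (F (- pi - per q) (2 * pi) - F (- pi - per q) (per q)).
Proof.
move=> cg dF; have /andP[r0 r1] := per_bound _ q; set r := per q in r0 r1 *.
have cfk k : continuous (fun x : R => cosh (x + k) * g x).
  move=> x; apply: cvgM; last exact: cg.
  apply: continuous_cvg; first exact: cosh_continuous.
  by apply: cvgD; [exact: cvg_id|exact: cvg_cst].
have it := peakon_mul_integrable _ q _ cg.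
have := Rintegral_itvB it (x := r).
rewrite !bnd_simp => /(_ r0 (ltW r1)) /eqP; rewrite subr_eq => /eqP ->.
rewrite addrC; congr (_ + _).
  rewrite -(Rintegral_FTC2 _ _ _ _ _ r0 (dF (pi - r)) (cfk _)).
  apply: eq_Rintegral => x /[!inE]/=; rewrite in_itv/= => /andP[x0 xr].
  rewrite peakon_normE; last by rewrite x0/=; lra.
  rewrite ler0_norm ?subr_le0// -coshN; congr (cosh _ * _); rewrite -/r; ring.
rewrite Rintegral_itv_obnd_cbnd; last first.
  apply: integrableS it => //; apply: subset_itvr => /=; by rewrite bnd_simp.
rewrite -(Rintegral_FTC2 _ _ _ _ _ (ltW r1) (dF (- pi - r)) (cfk _)).
apply: eq_Rintegral => x /[!inE]/=; rewrite in_itv/= => /andP[x0 xr].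
rewrite peakon_normE; last by rewrite xr andbT; lra.
rewrite ger0_norm ?subr_ge0//; congr (cosh _ * _); rewrite -/r; ring.
Qed.

(** The antiderivative results from two integrations by parts; its factor 1 / (1 + n^2) gives the
    decay of the Fourier coefficients. *)
Lemma der_cosh_cos (R : realType) (n k x : R) :
  is_derive x 1 (fun y => (1 + n ^+ 2)^-1 *
    (sinh (y + k) * cos (n * y) + n * (cosh (y + k) * sin (n * y))))
    (cosh (x + k) * cos (n * x)).
Proof.
have n0 : 1 + n ^+ 2 != 0 by rewrite gt_eqF// ltr_pwDl// sqr_ge0.
have dc := der_shift _ _ k _ _ (der_cosh _ (x + k)).
have ds := der_shift _ _ k _ _ (der_sinh _ (x + k)).
have dcos := der_scale _ _ n _ _ (is_derive_cos (n * x)).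
have dsin := der_scale _ _ n _ _ (is_derive_sin (n * x)).
apply: is_derive_eq (derZ _ _ _ _ _ (derD _ _ _ _ _ _
  (derM _ _ _ _ _ _ ds dcos) (derZ _ n _ _ _ (derM _ _ _ _ _ _ dc dsin)))) _.
by field.
Qed.

Lemma der_cosh_sin (R : realType) (n k x : R) :
  is_derive x 1 (fun y => (1 + n ^+ 2)^-1 *
    (sinh (y + k) * sin (n * y) - n * (cosh (y + k) * cos (n * y))))
    (cosh (x + k) * sin (n * x)).
Proof.
have n0 : 1 + n ^+ 2 != 0 by rewrite gt_eqF// ltr_pwDl// sqr_ge0.
have dc := der_shift _ _ k _ _ (der_cosh _ (x + k)).
have ds := der_shift _ _ k _ _ (der_sinh _ (x + k)).
have dcos := der_scale _ _ n _ _ (is_derive_cos (n * x)).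
have dsin := der_scale _ _ n _ _ (is_derive_sin (n * x)).
apply: is_derive_eq (derZ _ _ _ _ _ (derD _ _ _ _ _ _
  (derM _ _ _ _ _ _ ds dsin)
  (derN _ _ _ _ (derZ _ n _ _ _ (derM _ _ _ _ _ _ dc dcos))))) _.
by field.
Qed.

Lemma cos_scale_continuous (R : realType) (n : R) :
  continuous (fun x => cos (n * x)).
Proof.
move=> x; apply/differentiable_continuous/derivable1_diffP.
by case: (der_scale _ _ n _ _ (is_derive_cos (n * x))).
Qed.

Lemma sin_scale_continuous (R : realType) (n : R) :
  continuous (fun x => sin (n * x)).
Proof.
move=> x; apply/differentiable_continuous/derivable1_diffP.
by case: (der_scale _ _ n _ _ (is_derive_sin (n * x))).
Qed.

(** The terms at 0 and 2 pi cancel by periodicity. At the corner the [cosh pi] terms cancel and the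
    two [sinh pi] terms add up, whence the factor 2. *)
Lemma Rintegral_peakon_cos (R : realType) (q : R) (n : int) :
  (\int[lebesgue_measure]_(x in `[0%R, (2 * pi)%R])
     (peakon q x * cos (n%:~R * x)))%R =
  2 * sinh pi / (1 + n%:~R ^+ 2) * cos (n%:~R * q).
Proof.
rewrite (Rintegral_peakon_mul _ _ _ _ (cos_scale_continuous _ _)
  (der_cosh_cos _ n%:~R)).
rewrite cos_2pi_int sin_2pi_int mulr0 cos0 sin0 cos_per sin_per.
have -> : per q + (pi - per q) = pi by ring.
have -> : per q + (- pi - per q) = - pi by ring.
have -> : 2 * pi + (- pi - per q) = pi - per q by ring.
rewrite add0r coshN sinhN; field.
by rewrite gt_eqF// ltr_pwDl// sqr_ge0.
Qed.

Lemma Rintegral_peakon_sin (R : realType) (q : R) (n : int) :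
  (\int[lebesgue_measure]_(x in `[0%R, (2 * pi)%R])
     (peakon q x * sin (n%:~R * x)))%R =
  2 * sinh pi / (1 + n%:~R ^+ 2) * sin (n%:~R * q).
Proof.
rewrite (Rintegral_peakon_mul _ _ _ _ (sin_scale_continuous _ _)
  (der_cosh_sin _ n%:~R)).
rewrite cos_2pi_int sin_2pi_int mulr0 cos0 sin0 cos_per sin_per.
have -> : per q + (pi - per q) = pi by ring.
have -> : per q + (- pi - per q) = - pi by ring.
have -> : 2 * pi + (- pi - per q) = pi - per q by ring.
rewrite add0r coshN sinhN; field.
by rewrite gt_eqF// ltr_pwDl// sqr_ge0.
Qed.

Lemma Rintegral_peakon3_mul (R : realType) (A1 A2 A3 r1 r2 r3 : R) (g : R -> R) :
  continuous g ->
  (\int[lebesgue_measure]_(x in `[0%R, (2 * pi)%R])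
    ((A1 * peakon r1 x + A2 * peakon r2 x - A3 * peakon r3 x) * g x))%R =
  A1 * (\int[lebesgue_measure]_(x in `[0%R, (2 * pi)%R]) (peakon r1 x * g x))%R +
  A2 * (\int[lebesgue_measure]_(x in `[0%R, (2 * pi)%R]) (peakon r2 x * g x))%R -
  A3 * (\int[lebesgue_measure]_(x in `[0%R, (2 * pi)%R]) (peakon r3 x * g x))%R.
Proof.
move=> cg.
have it A r : lebesgue_measure.-integrable `[0, 2 * pi]
    (EFin \o (fun x => A * (peakon r x * g x))).
  have -> : EFin \o (fun x => A * (peakon r x * g x)) =
     (fun x => A%:E * ((EFin \o (fun x => (peakon r x * g x)%R)) x))%E.
    by apply/funext => x /=; rewrite EFinM.
  by apply: integrableZl => //; exact: peakon_mul_integrable.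
have mI : measurable (`[0, 2 * pi] : set R) by exact: measurable_itv.
transitivity (\int[lebesgue_measure]_(x in `[0%R, (2 * pi)%R])
    (A1 * (peakon r1 x * g x) + A2 * (peakon r2 x * g x)
     - A3 * (peakon r3 x * g x)))%R.
  by apply: eq_Rintegral => x _; ring.
rewrite RintegralB//; last first.
  have -> : EFin \o (fun x => A1 * (peakon r1 x * g x) +
                            A2 * (peakon r2 x * g x)) =
     ((EFin \o (fun x => A1 * (peakon r1 x * g x))%R) \+
      (EFin \o (fun x => A2 * (peakon r2 x * g x))%R))%E.
    by apply/funext => x /=; rewrite EFinD.
  exact: integrableD.
rewrite RintegralD// !RintegralZl//; exact: peakon_mul_integrable.
Qed.

Lemma normc_fourier_coef_peakon3 (R : realType) (A1 A2 A3 r1 r2 r3 : R)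
    (n : int) :
  Normc.normc (fourier_coef
    (fun x => A1 * peakon r1 x + A2 * peakon r2 x - A3 * peakon r3 x) n) ^+ 2 =
  (sinh pi / pi / (1 + n%:~R ^+ 2)) ^+ 2 *
  ((A1 * cos (n%:~R * r1) + A2 * cos (n%:~R * r2) - A3 * cos (n%:~R * r3)) ^+ 2 +
   (A1 * sin (n%:~R * r1) + A2 * sin (n%:~R * r2) - A3 * sin (n%:~R * r3)) ^+ 2).
Proof.
rewrite /fourier_coef /Normc.normc sqr_sqrtr; last by rewrite addr_ge0 ?sqr_ge0.
rewrite !Rintegral_peakon3_mul; last first.
- exact: cos_scale_continuous.
- exact: sin_scale_continuous.
have pi0 : pi != 0 :> R by rewrite gt_eqF ?pi_gt0.
have n0 : 1 + n%:~R ^+ 2 != 0 :> R by rewrite gt_eqF// ltr_pwDl// sqr_ge0.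
rewrite !Rintegral_peakon_cos !Rintegral_peakon_sin.
have H (S p : R) : p != 0 -> S / p = 2 * S * (2 * p)^-1 by move=> p0; field.
by rewrite (H _ _ pi0); move: (2 * pi)^-1 (sinh pi) => c S; field.
Qed.

(** * Comparison of sums, Lipschitz bounds and left limits *)

Lemma esum_le_scale (R : realType) (T : choiceType) (I : set T) (c : R)
    (a b : T -> \bar R) : 0 <= c -> (forall i, 0 <= b i)%E ->
  (forall i, a i <= c%:E * b i)%E ->
  (\esum_(i in I) a i <= c%:E * \esum_(i in I) b i)%E.
Proof.
move=> c0 b0 ab; apply: ge_ereal_sup => _ [X IX <-].
apply: (@le_trans _ _ (\sum_(i \in X) (c%:E * b i))%E).
  by apply: lee_fsum => //; case: IX.
rewrite -ge0_mule_fsumr//; apply: lee_wpmul2l; first by rewrite lee_fin.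
by apply: esum_ge; exists X.
Qed.

Lemma derivable_lipschitz (R : realType) (f df : R -> R) (K a b : R) :
  (forall t, a < t < b -> is_derive t 1 f (df t)) ->
  (forall t, a < t < b -> `|df t| <= K) ->
  forall x y, a < x < b -> a < y < b -> `|f x - f y| <= K * `|x - y|.
Proof.
move=> fdf dfK; suff H x y : a < x < b -> a < y < b -> x <= y ->
  `|f x - f y| <= K * `|x - y|.
  move=> x y xab yab; have [xy|/ltW yx] := leP x y; first exact: H.
  by rewrite distrC (distrC x); exact: H.
move=> /andP[ax xb] /andP[ay yb] xy.
have [||c] := MVT_segment (f := f) (df := df) xy.
- move=> z; rewrite in_itv/= => /andP[xz zy]; apply: fdf.
  by rewrite (lt_trans ax)//= (lt_trans zy).
- apply: derivable_within_continuous => z; rewrite in_itv/= => /andP[xz zy].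
  have azb : a < z < b by rewrite (lt_le_trans ax)//= (le_lt_trans zy).
  by case: (fdf _ azb).
- rewrite in_itv/= => /andP[xc cy] E.
  rewrite distrC E normrM (distrC x) ler_wpM2r// dfK//.
  by rewrite (lt_le_trans ax)//= (le_lt_trans cy).
Qed.

(** [f t + K * t] is nondecreasing and bounded above near [b], so it has a left limit by
    monotonicity; the linear term is then removed. *)
Lemma lipschitz_is_cvg_at_left (R : realType) (f : R -> R) (K a b : R) : a < b ->
  (forall x y, a < x < b -> a < y < b -> `|f x - f y| <= K * `|x - y|) ->
  cvg (f t @[t --> b^'-]).
Proof.
move=> ab fK.
have fK' x y : a < x < b -> a < y < b -> x <= y -> `|f y - f x| <= K * (y - x).
  by move=> xab yab xy; rewrite (le_trans (fK _ _ yab xab))// ger0_norm// subr_ge0.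
have gcvg : cvg (f t + K * t @[t --> b^'-]).
  apply: nondecreasing_at_left_is_cvgr; near=> c.
  - have ac : a < c by near: c; exact: nbhs_left_gt.
    move=> x y /[!in_itv]/= /andP[cx xb] /andP[cy yb] xy.
    have := fK' x y; rewrite xb yb !(lt_trans ac)//= => /(_ erefl erefl xy).
    by rewrite ler_norml; lra.
  - have /andP[ac cb] : a < c < b.
      by apply/andP; split; near: c; [exact: nbhs_left_gt|exact: nbhs_left_lt].
    pose m := (c + b) / 2.
    have K0 : 0 <= K.
      have := fK c m; rewrite ac cb/= => /(_ erefl).
      have -> /= : a < m < b by rewrite /m; lra.
      move=> /(_ erefl) h; have : 0 <= K * `|c - m| by exact: le_trans h.
      by rewrite pmulr_lge0// normr_gt0 /m; lra.
    exists (f c + K * (b - c) + K * b) => _ [x /=] /[!in_itv]/= /andP[cx xb] <-.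
    have := fK' c x; rewrite ac cb xb (lt_trans ac)//= => /(_ erefl erefl (ltW cx)).
    have : 0 <= K * (b - x) by rewrite mulr_ge0// subr_ge0 ltW.
    by rewrite ler_norml; lra.
have -> : f = (fun t => (f t + K * t) - K * t) by apply/funext => t; rewrite addrK.
apply: is_cvgB => //; apply/cvg_ex; exists (K * b).
by apply: cvg_at_left_filter; apply: cvgM; [exact: cvg_cst|exact: cvg_id].
Unshelve. all: by end_near. Qed.

Lemma cvg_powR0 (R : realType) (T : Type) (F : set_system T) (f : T -> R) (e : R) :
  Filter F -> 0 < e -> (\forall t \near F, 0 <= f t) ->
  f t @[t --> F] --> (0 : R) -> f t `^ e @[t --> F] --> (0 : R).
Proof.
move=> FF e0 f0 /cvgr0Pnorm_lt cf; apply/cvgr0Pnorm_lt => eta eta0.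
have := cf (eta `^ e^-1) (powR_gt0 _ eta0).
apply: filterS2 f0 => t f0; rewrite ger0_norm// ger0_norm ?powR_ge0// => lt.
have := gt0_ltr_powR e0 _ _ lt; rewrite !nnegrE powR_ge0 => /(_ f0 erefl).
by rewrite -powRrM mulVf ?gt_eqF// powRr1// ltW.
Qed.

(** * Chord estimates and the uniform Sobolev bound *)

(** Cosine and sine are 1-Lipschitz, and each contributes one (x - y)^2. *)
Lemma cos_sin_chord (R : realType) (x y : R) :
  (cos x - cos y) ^+ 2 + (sin x - sin y) ^+ 2 <= 2 * (x - y) ^+ 2.
Proof.
pose m : R := Num.min x y - 1; pose M : R := Num.max x y + 1.
have xM : m < x < M by rewrite /m /M; case: (leP x y) => h; lra.
have yM : m < y < M by rewrite /m /M; case: (leP x y) => h; lra.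
have dcos : `|cos x - cos y| <= 1 * `|x - y|.
  apply: (derivable_lipschitz _ (@cos R) (fun z => - sin z) 1 m M) => // t _.
  by rewrite normrN ler_norml sin_geN1 sin_le1.
have dsin : `|sin x - sin y| <= 1 * `|x - y|.
  apply: (derivable_lipschitz _ (@sin R) (@cos R) 1 m M) => // t _.
  by rewrite ler_norml cos_geN1 cos_le1.
rewrite !mul1r in dcos dsin.
rewrite mulr2n mulrDl mul1r -[X in X + _ <= _]real_normK ?num_real//.
rewrite -[X in _ + X <= _]real_normK ?num_real//.
rewrite -[X in _ <= X + X]real_normK ?num_real//.
by apply: lerD; rewrite lerXn2r// nnegrE.
Qed.

(** With z = (n x - n y)^2, the chord bound 2 z is used for z <= 1, where z <= z^theta, and the
    trivial bound 8 for z > 1, where 1 <= z^theta. Enlarging n^2 to 1 + n^2 yields a power of the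
    Sobolev weight. *)
Lemma cos_sin_chord_powR (R : realType) (theta n x y : R) : 0 < theta <= 1 ->
  (cos (n * x) - cos (n * y)) ^+ 2 + (sin (n * x) - sin (n * y)) ^+ 2
    <= 8 * (1 + n ^+ 2) `^ theta * ((x - y) ^+ 2) `^ theta.
Proof.
move=> /andP[th0 th1]; set L := leLHS.
pose z := (n * x - n * y) ^+ 2.
have z0 : 0 <= z by exact: sqr_ge0.
have L1 : L <= 2 * z by exact: cos_sin_chord.
have L2 : L <= 8.
  rewrite /L; have := cos2Dsin2 (n * x); have := cos2Dsin2 (n * y).
  have := sqr_ge0 (cos (n * x) + cos (n * y)).
  have := sqr_ge0 (sin (n * x) + sin (n * y)).
  rewrite !expr2; lra.
have L3 : L <= 8 * z `^ theta.
  have [z1|z1] := leP z 1.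
    apply: (le_trans L1); have [z_0|zn0] := eqVneq z 0.
      by rewrite z_0 mulr0 mulr_ge0// powR_ge0.
    have : z <= z `^ theta.
      by apply: ger1_powR => //; rewrite lt_neqAle eq_sym zn0 z0.
    by lra.
  rewrite (le_trans L2)// ler_peMr//.
  have := ge0_ler_powR (ltW th0) _ _ (ltW z1).
  by rewrite !nnegrE powR1; apply.
have n2 : 0 <= 1 + n ^+ 2 by rewrite addr_ge0// sqr_ge0.
have xy2 := sqr_ge0 (x - y).
apply: (le_trans L3); rewrite -mulrA ler_wpM2l// -powRM//.
apply: ge0_ler_powR; rewrite ?nnegrE//; [exact: ltW|exact: mulr_ge0|].
by rewrite /z -mulrBr exprMn mulrDl mul1r lerDr.
Qed.

(** [K] is uniform in amplitudes and positions because these vary with time in the application.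
    Measuring every phase from [r1] isolates the total amplitude A1 + A2 - A3, and the series left
    over converges because 2 - s - theta > 1/2. *)
Lemma sobolev_norm_peakon3_le (R : realType) (s theta : R) :
  0 < theta <= 1 -> s + theta < 3 / 2 ->
  exists K : R, forall A1 A2 A3 r1 r2 r3 : R,
  (sobolev_norm s
      (fun x => A1 * peakon r1 x + A2 * peakon r2 x - A3 * peakon r3 x)%R
   <= sqrte (K * ((A1 + A2 - A3) ^+ 2 + A2 ^+ 2 * ((r2 - r1) ^+ 2) `^ theta
                  + A3 ^+ 2 * ((r3 - r1) ^+ 2) `^ theta))%R%:E)%E.
Proof.
move=> /[dup] thI /andP[th0 th1] sth.
(* The exponent collects the weight [s], the decay -2 of the squared coefficients and the loss
   [theta] of the chord bound. *)
pose b (n : int) := (((1 + n%:~R ^+ 2) `^ (- (2 - s - theta)))%:E : \bar R).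
have b0 n : (0 <= b n)%E by rewrite lee_fin powR_ge0.
have S_lty : (\esum_(n in [set: int]) b n < +oo)%E.
  by apply: esum_int_japanese_lty; lra.
have S_ge0 : (0 <= \esum_(n in [set: int]) b n)%E by exact: esum_ge0.
pose S := fine (\esum_(n in [set: int]) b n)%E.
have SE : (\esum_(n in [set: int]) b n = S%:E)%E by rewrite fineK// ge0_fin_numE.
(* 24 is 3 times 8: the square of a sum of three terms costs 3, the chord bound costs 8. *)
pose c := 24 * (sinh pi / pi) ^+ 2 : R.
have c0 : 0 <= c by rewrite mulr_ge0// sqr_ge0.
exists (c * S) => A1 A2 A3 r1 r2 r3.
set G := _ + _ ^+ 2 * _ `^ theta.
have sqp (u v : R) : 0 <= u ^+ 2 * v `^ theta.
  by rewrite mulr_ge0 ?sqr_ge0 ?powR_ge0.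
have G0 : 0 <= G by rewrite addr_ge0// addr_ge0// sqr_ge0.
rewrite /sobolev_norm lee_sqrt; last first.
  by rewrite lee_fin mulr_ge0// mulr_ge0// fine_ge0.
have E : ((c * S * G)%R%:E = (c * G)%R%:E * \esum_(n in [set: int]) b n)%E.

  by rewrite SE -EFinM mulrAC.
rewrite E.
apply: (esum_le_scale _ _ _ _ _ b) => // [|n]; first exact: mulr_ge0.
rewrite -EFinM lee_fin normc_fourier_coef_peakon3.
set N := 1 + n%:~R ^+ 2; set m : R := n%:~R.
have N1 : 1 <= N by rewrite lerDl sqr_ge0.
have N0 : 0 < N by lra.
have Nth1 : 1 <= N `^ theta.
  have := ge0_ler_powR (ltW th0) _ _ N1.
  by rewrite !nnegrE powR1; apply => //; exact: ltW.
set Q := (X in _ * (_ * X) <= _).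
have QG : Q <= 24 * N `^ theta * G.
  have C21 := cos_sin_chord_powR _ _ m r2 r1 thI.
  have C31 := cos_sin_chord_powR _ _ m r3 r1 thI.
  have U := cos2Dsin2 (m * r1).
  have sq3 (u v w : R) : (u + v - w) ^+ 2 <= 3 * (u ^+ 2 + v ^+ 2 + w ^+ 2).
    have := sqr_ge0 (u - v); have := sqr_ge0 (u + w); have := sqr_ge0 (v + w).
    by rewrite !expr2; lra.
  pose w := A1 + A2 - A3.
  have E1 (h : R -> R) : A1 * h (m * r1) + A2 * h (m * r2) - A3 * h (m * r3) =
    w * h (m * r1) + A2 * (h (m * r2) - h (m * r1))
    - A3 * (h (m * r3) - h (m * r1)).
    by rewrite /w; ring.
  have := sq3 (w * cos (m * r1)) (A2 * (cos (m * r2) - cos (m * r1)))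
    (A3 * (cos (m * r3) - cos (m * r1))).
  have := sq3 (w * sin (m * r1)) (A2 * (sin (m * r2) - sin (m * r1)))
    (A3 * (sin (m * r3) - sin (m * r1))).
  rewrite /Q -/m (E1 (@cos R)) (E1 (@sin R)).
  rewrite !(exprMn _ w) !(exprMn _ A2) !(exprMn _ A3).
  have := ler_wpM2l (sqr_ge0 A2) C21; have := ler_wpM2l (sqr_ge0 A3) C31.
  have : w ^+ 2 <= N `^ theta * w ^+ 2 by rewrite ler_peMl// sqr_ge0.
  have : w ^+ 2 * cos (m * r1) ^+ 2 + w ^+ 2 * sin (m * r1) ^+ 2 = w ^+ 2.
    by rewrite -mulrDr U mulr1.
  have := sqr_ge0 w; rewrite /G -/w -/N.
  move: (N `^ theta) (((r2 - r1) ^+ 2) `^ theta) (((r3 - r1) ^+ 2) `^ theta).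
  move=> P X Y.
  by lra.
have -> : c * G * N `^ (- (2 - s - theta)) = 
   (N `^ s * (sinh pi / pi / N) ^+ 2) * (24 * N `^ theta * G).
  have -> : - (2 - s - theta) = s + theta - 2%:R by ring.
  have Nn0 : N != 0 by rewrite gt_eqF.
  rewrite powRB ?Nn0 ?implybT// powRD ?Nn0 ?implybT// powR_mulrn ?ltW//.
  rewrite /c !expr2; set u := sinh pi / pi; field.
  by [].
by rewrite mulrA ler_wpM2l// mulr_ge0 ?powR_ge0 ?sqr_ge0.
Qed.

(** * Interior derivatives and hyperbolic estimates *)

(** The limit along [A] becomes a full one because [A] is a neighbourhood of [t]; Caratheodory's
    criterion then needs only the difference quotient extended by [l] at [t]. *)
Lemma is_derive_in_interior (R : realType) (A : set R) (f : R -> R) (t l : R) :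
  nbhs t A -> is_derive_in A f t l -> is_derive t 1 f l.
Proof.
move=> At fl; apply/is_derive1_caratheodory.
pose g z := if z == t then l else (f z - f t) / (z - t).
have gt : g t = l by rewrite /g eqxx.
exists g; split => //.
- move=> z; rewrite /g; case: eqP => [->|/eqP zt]; first by rewrite !subrr mulr0.
  by rewrite divfK// subr_eq0.
- have : g z @[z --> t] --> g t; last by [].
  rewrite gt; apply/cvgrPdist_lt => e e0.
  have /cvgrPdist_lt/(_ _ e0) := fl; rewrite !near_withinE => H.
  apply: filterS2 At H => z Az H; rewrite /g.
  case: eqP => [_|/eqP zt]; first by rewrite subrr normr0.
  exact: H.
Qed.

Lemma cosh_gt0 (R : realType) (x : R) : 0 < cosh x.
Proof. by rewrite divr_gt0// addr_gt0 ?expR_gt0. Qed.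

Lemma ler_sinh (R : realType) (x y : R) : x <= y -> sinh x <= sinh y.
Proof.
move=> xy; rewrite ler_pM2r ?invr_gt0// lerB// ler_expR//.
by rewrite lerN2.
Qed.

Lemma sinh1_gt0 (R : realType) : 0 < sinh (1 : R).
Proof. by rewrite divr_gt0// subr_gt0 ltr_expR; lra. Qed.

Lemma sinh_lt_cosh (R : realType) (x : R) : sinh x < cosh x.
Proof.
rewrite ltr_pM2r ?invr_gt0// ltrD2l.
by have := expR_gt0 (- x); lra.
Qed.

(** Mean value theorem for [cosh] on [[pi - q, pi]], where [sinh] lies between [sinh 1] and
    [sinh pi] because pi >= 2. Divided by [cosh pi], this makes 1 - E(q) of exact order q. *)
Lemma cosh_pi_sub_bounds (R : realType) (q : R) : 0 < q < 1 / 2 ->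
  sinh 1 * q <= cosh pi - cosh (q - pi) <= sinh pi * q.
Proof.
move=> /andP[q0 q1]; have pi2 := pi_ge2 R.
rewrite -(coshN _ (q - pi)) opprB.
have [|||x] := @MVT R (@cosh R) (@sinh R) (pi - q) pi.
- by lra.
- by move=> x _; exact: der_cosh.
- by apply: continuous_subspaceT; exact: cosh_continuous.
rewrite in_itv/= => /andP[x1 x2] ->.
have -> : pi - (pi - q) = q by ring.
by apply/andP; split; rewrite ler_wpM2r ?(ltW q0)// ler_sinh//; lra.
Qed.

Lemma sqr_le_bound (R : realType) (x m : R) : x ^+ 2 <= m -> `|x| <= 1 + m.
Proof.
move=> xm; have := sqr_ge0 (`|x| - 1); rewrite -(real_normK (num_real x)) in xm.
by rewrite !expr2 in xm *; have := normr_ge0 x; lra.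
Qed.

Lemma derivable_constant (R : realType) (f : R -> R) (a b : R) :
  (forall t, a < t < b -> is_derive t 1 f 0) ->
  forall x y, a < x < b -> a < y < b -> f x = f y.
Proof.
move=> df x y xab yab; apply/eqP; rewrite -subr_eq0 -normr_le0.
have := derivable_lipschitz _ f (fun=> 0) 0 a b df _ x y xab yab.
by rewrite mul0r; apply => t _; rewrite normr0.
Qed.

(** * Conserved quantities and rates at the collision *)

Section collision.
Context (R : realType) (q1 q2 p1 p2 : R -> R) (t0 T : R).
Let c : R := cosh pi.
Let q t := q2 t - q1 t.
(** [e] and [de] omit the periodic reduction, which is trivial under the smallness of [q]; they are
    thus smooth in [q]. *)
Let e t := c^-1 * cosh (q t - pi).
Let de t := c^-1 * sinh (q t - pi).
Let A t := p1 t + p2 t * e t.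
Let B t := p1 t * e t + p2 t.
Let dp1 t := c ^+ 2 * p1 t * p2 t * A t * de t.
Let dp2 t := - (c ^+ 2 * p1 t * p2 t * B t * de t).

Hypothesis t0T : t0 < T.
Hypothesis q_small : forall t, t0 < t < T -> 0 < q t < 1 / 2.
Hypothesis dq1 : forall t, t0 < t < T -> is_derive t 1 q1 (c ^+ 2 * A t ^+ 2).
Hypothesis dq2 : forall t, t0 < t < T -> is_derive t 1 q2 (c ^+ 2 * B t ^+ 2).
Hypothesis dp1E : forall t, t0 < t < T -> is_derive t 1 p1 (dp1 t).
Hypothesis dp2E : forall t, t0 < t < T -> is_derive t 1 p2 (dp2 t).

Let dq t := c ^+ 2 * (B t ^+ 2 - A t ^+ 2).

Let der_e t : t0 < t < T -> is_derive t 1 e (de t * dq t).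
Proof.
move=> tI.
have dqt : is_derive t 1 (fun s => q s - pi) (dq t).
  apply: is_derive_eq (derD _ _ _ _ _ _ (derD _ _ _ _ _ _ (dq2 _ tI)
    (derN _ _ _ _ (dq1 _ tI))) (is_derive_cst (- pi : R) t 1)) _.
  by rewrite /dq addr0; ring.
apply: is_derive_eq (derZ _ c^-1 _ _ _
  (der_comp _ _ _ _ _ _ (der_cosh _ _) dqt)) _.
by rewrite /de mulrA.
Qed.

(* [H] is, up to a constant factor, the square of the H^1 norm of u. *)
Let H t := p1 t * p1 t + p2 t * p2 t + 2 * (p1 t * p2 t * e t).
Let M t := (p1 t * p2 t * (p1 t * p2 t)) * (1 + - (e t * e t)).

(** As A = p1 + p2 e and B = p1 e + p2, the derivatives of p1 and p2 contribute 2 c^2 p1 p2 [de]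
    (A^2 - B^2) in total, and the derivative of [e] contributes the opposite. *)
Let H_const t s : t0 < t < T -> t0 < s < T -> H t = H s.
Proof.
apply: derivable_constant => {}t tI.
have d1 := dp1E _ tI; have d2 := dp2E _ tI; have d3 := der_e _ tI.
apply: is_derive_eq (derD _ _ _ _ _ _ (derD _ _ _ _ _ _ (derM _ _ _ _ _ _ d1 d1)
  (derM _ _ _ _ _ _ d2 d2))
  (derZ _ 2 _ _ _ (derM _ _ _ _ _ _ (derM _ _ _ _ _ _ d1 d2) d3))) _.
by rewrite /dp1 /dp2 /dq /A /B; ring.
Qed.

(** A p2 - B p1 = e (p2^2 - p1^2) governs the derivative of p1 p2, and B^2 - A^2 = (1 - e^2) (p2^2 -
    p1^2) that of [e]; the two contributions cancel. *)
Let M_const t s : t0 < t < T -> t0 < s < T -> M t = M s.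
Proof.
apply: derivable_constant => {}t tI.
have d1 := dp1E _ tI; have d2 := dp2E _ tI; have d3 := der_e _ tI.
have dP := derM _ _ _ _ _ _ d1 d2.
apply: is_derive_eq (derM _ _ _ _ _ _ (derM _ _ _ _ _ _ dP dP)
  (derD _ _ _ _ _ _ (is_derive_cst (1 : R) t 1)
    (derN _ _ _ _ (derM _ _ _ _ _ _ d3 d3)))) _.
by rewrite /cst/= /dp1 /dp2 /dq /A /B; ring.
Qed.

Lemma collision_bounds : exists2 K : R, forall t, t0 < t < T ->
    p2 t ^+ 2 * Num.sqrt (q2 t - q1 t) <= K &
  cvg (q1 t @[t --> T^'-]) /\ cvg (p1 t + p2 t @[t --> T^'-]).
Proof.
pose m := (t0 + T) / 2.
have mI : t0 < m < T by move: t0T; rewrite /m => h; lra.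
have c_gt0 : 0 < c by exact: cosh_gt0.
pose c0 := c^-1 * sinh 1.
have c0_gt0 : 0 < c0 by rewrite mulr_gt0 ?invr_gt0// sinh1_gt0.
have x_bounds t : t0 < t < T -> c0 * q t <= 1 - e t <= q t.
  move=> tI; have /andP[h1 h2] := cosh_pi_sub_bounds _ _ (q_small _ tI).
  have /andP[q0 _] := q_small _ tI.
  have -> : 1 - e t = c^-1 * (cosh pi - cosh (q t - pi)).
    by rewrite mulrBr mulVf ?gt_eqF.
  rewrite /c0 -mulrA ler_pM2l ?invr_gt0// h1/= mulrC ler_pdivrMr//.
  by rewrite (le_trans h2)// mulrC ler_pM2l// ltW// sinh_lt_cosh.
have e_ge0 t : 0 <= e t by rewrite mulr_ge0 ?invr_ge0 ?ltW// cosh_gt0.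
have de_le1 t : t0 < t < T -> `|de t| <= 1.
  move=> tI; have /andP[q_gt0 q_lt] := q_small _ tI; have pi2 := pi_ge2 R.
  rewrite normrM gtr0_norm ?invr_gt0// mulrC ler_pdivrMr// mul1r.
  rewrite -normrN -sinhN ger0_norm.
    by rewrite (le_trans _ (ltW (sinh_lt_cosh _ _)))// ler_sinh//; lra.
  by rewrite (le_trans (ltW (sinh1_gt0 R)))// ler_sinh//; lra.
pose P t := p1 t * p2 t.
(* From (p1 p2)^2 c0 q <= (p1 p2)^2 (1 - e) (1 + e) = M; the added 1 comes from [sqr_le_bound]. *)
pose b := 1 + M m / c0.
have P_le t : t0 < t < T -> `|P t * Num.sqrt (q t)| <= b.
  move=> tI; have /andP[x1 x2] := x_bounds _ tI.
  have /andP[q_gt0 q_lt] := q_small _ tI.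
  apply: sqr_le_bound; rewrite exprMn (sqr_sqrtr (ltW q_gt0)) ler_pdivlMr//.
  rewrite (M_const _ _ mI tI) /M -/(P t).
  have -> : P t * P t * (1 - e t * e t) = P t ^+ 2 * ((1 - e t) * (1 + e t)).
    by ring.
  rewrite -mulrA ler_wpM2l ?sqr_ge0// mulrC (le_trans x1)// ler_peMr//.
    by rewrite (le_trans _ x1)// mulr_ge0 ?ltW.
  by rewrite lerDl.
(* Multiply p1^2 + p2^2 = H - 2 p1 p2 e by sqrt q <= 1 and bound the last term by means of [b]. *)
pose D := `|H m| + 2 * b.
have p_le t : t0 < t < T -> (p1 t ^+ 2 + p2 t ^+ 2) * Num.sqrt (q t) <= D.
  move=> tI; have /andP[x1 x2] := x_bounds _ tI.
  have /andP[q_gt0 q_lt] := q_small _ tI.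
  have r0 : 0 < Num.sqrt (q t) by rewrite sqrtr_gt0.
  have r1 : Num.sqrt (q t) <= 1 by rewrite -sqrtr1 ler_wsqrtr//; lra.
  have e1 : e t <= 1.
    have : 0 <= c0 * q t by rewrite mulr_ge0 ?ltW.
    by lra.
  have -> : p1 t ^+ 2 + p2 t ^+ 2 = H m - 2 * (P t * e t).
    by rewrite (H_const _ _ mI tI) /H /P; ring.
  rewrite mulrBl lerD//.
    by rewrite (le_trans (ler_norm _))// normrM ler_piMr// ger0_norm.
  have -> : - (2 * (P t * e t) * Num.sqrt (q t)) =
    2 * (- (P t * Num.sqrt (q t)) * e t).
    by ring.
  rewrite ler_pM2l// (le_trans (ler_norm _))// (le_trans _ (P_le _ tI))//.
  by rewrite normrM normrN (ger0_norm (e_ge0 t)) ler_piMr.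
exists D.
  move=> t tI; apply: le_trans (p_le _ tI); rewrite ler_wpM2r ?sqrtr_ge0//.
  by rewrite lerDr sqr_ge0.
split.
- apply: (lipschitz_is_cvg_at_left _ _ (c ^+ 2 * H m) t0) => //.
  apply: (derivable_lipschitz _ _ _ _ _ _ dq1) => t tI.
  rewrite normrM !ger0_norm ?sqr_ge0// ler_wpM2l ?sqr_ge0//.
  have /andP[x1 x2] := x_bounds _ tI.
  have /andP[q_gt0 q_lt] := q_small _ tI.
  (* Here q1' <= c^2 H follows from conservation of [H], since H - A^2 = p2^2 (1 - e^2) >= 0. *)
  rewrite (H_const _ _ mI tI) -subr_ge0.
  have -> : H t - A t ^+ 2 = p2 t ^+ 2 * ((1 - e t) * (1 + e t)).
    by rewrite /H /A; ring.
  have x_ge0 : 0 <= 1 - e t by rewrite (le_trans _ x1)// mulr_ge0 ?ltW.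
  by rewrite mulr_ge0 ?sqr_ge0// mulr_ge0// addr_ge0.
- apply: (lipschitz_is_cvg_at_left _ _ (c ^+ 2 * ((1 + 2 * D) * b)) t0) => //.
  have dw t : t0 < t < T -> is_derive t 1 (fun s => p1 s + p2 s) (dp1 t + dp2 t).
    by move=> tI; apply: derD; [exact: dp1E|exact: dp2E].
  apply: (derivable_lipschitz _ _ _ _ _ _ dw) => t tI.
  have /andP[x1 x2] := x_bounds _ tI.
  have /andP[q_gt0 q_lt] := q_small _ tI.
  (* A - B = (p1 - p2) (1 - e) brings out a factor of order q. *)
  have -> : dp1 t + dp2 t = c ^+ 2 * ((p1 t - p2 t) * P t * (1 - e t) * de t).
    by rewrite /dp1 /dp2 /A /B /P; ring.
  rewrite normrM ger0_norm ?sqr_ge0// ler_wpM2l ?sqr_ge0//.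
  rewrite normrM -[leRHS]mulr1 ler_pM//; last exact: de_le1.
  have r0 : 0 < Num.sqrt (q t) by rewrite sqrtr_gt0.
  have r1 : Num.sqrt (q t) <= 1 by rewrite -sqrtr1 ler_wsqrtr//; lra.
  have x_ge0 : 0 <= 1 - e t by rewrite (le_trans _ x1)// mulr_ge0 ?ltW.
  (* With 1 - e <= q, one factor sqrt q goes to p1 - p2 and one to p1 p2, and both products stay
     bounded. *)
  apply: (@le_trans _ _ (`|(p1 t - p2 t) * Num.sqrt (q t)| *
                         `|P t * Num.sqrt (q t)|)).
    rewrite -normrM mulrACA -expr2 (sqr_sqrtr (ltW q_gt0)).
    rewrite [leLHS]normrM [leRHS]normrM.
    by rewrite ler_wpM2l// !ger0_norm// ltW.
  apply: ler_pM => //; last exact: P_le.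
  apply: sqr_le_bound; rewrite exprMn.
  have s2 : (p1 t - p2 t) ^+ 2 * Num.sqrt (q t) <= 2 * D.
    have := p_le _ tI; have := mulr_ge0 (sqr_ge0 (p1 t + p2 t)) (ltW r0).
    by rewrite !expr2; lra.
  apply: le_trans s2; rewrite ler_wpM2l ?sqr_ge0// expr2 ler_piMr// ltW.
Qed.

End collision.

(** * Convergence in the Sobolev norm up to the collision time *)

Theorem theorem8 (R : realType) (a b delta T : R) (q1 q2 p1 p2 : R -> R)
    (ha : 0 < a <= 1 / 4) (hb : 1 < b) (hdelta : 0 < delta)
    (hsol : peakon_antipeakon a b delta T q1 q2 p1 p2) :
  let wT : R := lim ((p1 t + p2 t) @[t --> T^'-]) in
  let qT : R := lim (q1 t @[t --> T^'-]) in
  let vT : R -> R := fun x => wT * peakon qT x in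
  forall s : R, s < 5 / 4 ->
    sobolev_norm s (fun x => two_peakon q1 q2 p1 p2 t x - vT x)
      @[t --> T^'-] --> (0%E : \bar R).
Proof.
move=> wT qT vT s s54.
(* Past [t0] the gap is below 1/2, so [per] acts trivially on it, and every time lies in the
   interior of [[0, T[], so derivatives are two-sided. *)
have [t0 [t0_ge0 t0T q_small]] : exists t0 : R, [/\ 0 <= t0, t0 < T &
    forall t : R, t0 < t < T -> 0 < q2 t - q1 t < 1 / 2].
  have /cvgr0Pnorm_lt/(_ (1 / 2)) := pa_collision hsol.
  have -> : 0 < 1 / 2 :> R by lra.
  move=> /(_ erefl); rewrite near_withinE => /nbhs_ballP[d /= d0 ballP].
  exists (Num.max 0 (T - d)); split.
  - by rewrite le_max lexx.
  - by rewrite gt_max (pa_T_gt0 hsol) ltrBlDr ltrDl.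
  - move=> t /andP[]; rewrite gt_max => /andP[t_gt0 Td] tT.
    have -> /= : 0 < q2 t - q1 t by apply: (pa_q_gt0 hsol); rewrite (ltW t_gt0).
    apply: (le_lt_trans (ler_norm _)).
    apply: ballP => //; rewrite /ball/= ger0_norm; lra.
have tI t : t0 < t < T -> nbhs t `[0, T[%classic.
  move=> /andP[t0t tT].
  have /near_in_itvoo : t \in `]0, T[ by rewrite in_itv/= tT (le_lt_trans t0_ge0).
  by apply: filterS => z; rewrite /= !in_itv/= => /andP[/ltW -> ->].
have tI' t : t0 < t < T -> 0 <= t < T.
  by move=> /andP[t0t ->]; rewrite (le_trans t0_ge0)// ltW.
have EfunE t : t0 < t < T ->
    Efun (q2 t - q1 t) = (cosh pi)^-1 * cosh (q2 t - q1 t - pi) /\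
    dEfun (q2 t - q1 t) = (cosh pi)^-1 * sinh (q2 t - q1 t - pi).
  move=> /q_small/andP[q_gt0 q_lt]; rewrite /Efun /dEfun per_id//.
  by have := pi_ge2 R; lra.
have dq1 t (h : t0 < t < T) :=
  is_derive_in_interior _ _ _ _ _ (tI _ h) (pa_dq1 hsol (tI' _ h)).
have dq2 t (h : t0 < t < T) :=
  is_derive_in_interior _ _ _ _ _ (tI _ h) (pa_dq2 hsol (tI' _ h)).
have dp1 t (h : t0 < t < T) :=
  is_derive_in_interior _ _ _ _ _ (tI _ h) (pa_dp1 hsol (tI' _ h)).
have dp2 t (h : t0 < t < T) :=
  is_derive_in_interior _ _ _ _ _ (tI _ h) (pa_dp2 hsol (tI' _ h)).
have [D p2_le [q1_cvg w_cvg]] : exists2 K : R, forall t, t0 < t < T ->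
    p2 t ^+ 2 * Num.sqrt (q2 t - q1 t) <= K &
  cvg (q1 t @[t --> T^'-]) /\ cvg (p1 t + p2 t @[t --> T^'-]).
  by apply: (collision_bounds R q1 q2 p1 p2 t0 T t0T q_small) => t h;
    have [E1 E2] := EfunE _ h; rewrite -?E1 -?E2;
    [exact: dq1|exact: dq2|exact: dp1|exact: dp2].
have near_I : \forall t \near T^'-, t0 < t < T.
  near=> t; apply/andP; split; near: t; [exact: nbhs_left_gt|exact: nbhs_left_lt].
(* Half the room below 5/4 keeps s + theta < 3/2; the cap by 1 keeps theta <= 1 when [s] is very
   negative. *)
pose eps := Num.min (5 / 4 - s) 1 / 2.
have eps_gt0 : 0 < eps by rewrite divr_gt0// lt_min subr_gt0 s54/=.
have eps_le : eps <= (5 / 4 - s) / 2 /\ eps <= 1 / 2.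
  by rewrite !ler_pM2r ?invr_gt0// !ge_min lexx lexx orbT.
pose theta := 1 / 4 + eps.
have th1 : 0 < theta <= 1 by rewrite /theta; lra.
have th2 : s + theta < 3 / 2 by rewrite /theta; lra.
have [K le_K] := sobolev_norm_peakon3_le _ _ _ th1 th2.
(* The bound of [le_K] for the peaks [q1 t], [q2 t], [qT], with amplitudes [p1 t], [p2 t], [wT]. *)
pose G t := (p1 t + p2 t - wT) ^+ 2 + p2 t ^+ 2 * ((q2 t - q1 t) ^+ 2) `^ theta
  + wT ^+ 2 * ((qT - q1 t) ^+ 2) `^ theta.
have G_cvg : G t @[t --> T^'-] --> (0 : R).
  have -> : 0 = 0 ^+ 2 + 0 + wT ^+ 2 * 0 :> R by rewrite expr0n mulr0 !addr0.
  apply: cvgD; first apply: cvgD.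
  - apply: cvgM; (have -> : 0 = wT - wT by rewrite subrr);
      by apply: cvgB; [exact: w_cvg|exact: cvg_cst].
  - have q_cvg : (q2 t - q1 t) `^ (2 * eps) @[t --> T^'-] --> (0 : R).
      apply: cvg_powR0; [exact: mulr_gt0| |exact: pa_collision hsol].
      by apply: filterS near_I => t /q_small/andP[/ltW].
    apply: (@squeeze_cvgr _ _ _ _ (fun=> 0)
      (fun t => D * (q2 t - q1 t) `^ (2 * eps))).
    + apply: filterS near_I => t h; have /andP[q_gt0 _] := q_small _ h.
      rewrite mulr_ge0 ?sqr_ge0 ?powR_ge0//=.
      rewrite -(powR_mulrn 2 (ltW q_gt0)) -powRrM.
      (* q^(2 theta) = q^(1/2) q^(2 eps): the first factor absorbs the growth of p2^2, the second
         tends to 0. *)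
      have -> : 2 * theta = 2^-1 + 2 * eps by rewrite /theta; lra.
      rewrite powRD ?(gt_eqF q_gt0) ?implybT// (powR12_sqrt (ltW q_gt0)) mulrA.
      by rewrite ler_wpM2r ?powR_ge0// p2_le.
    + exact: cvg_cst.
    + by rewrite -(mulr0 D); apply: cvgM => //; exact: cvg_cst.
  - apply: cvgM; first exact: cvg_cst.
    apply: cvg_powR0; [by case/andP: th1|by near=> t; exact: sqr_ge0|].
    have -> : 0 = (qT - qT) * (qT - qT) :> R by rewrite subrr mulr0.
    by apply: cvgM; apply: cvgB; (exact: cvg_cst || exact: q1_cvg).
(* The difference of [two_peakon] and [vT] is by definition the combination of three peakons treated
   by [le_K]. *)
apply: (@squeeze_cvge _ _ _ _ (fun=> 0%E) _ (fun t => sqrte (K * G t)%:E)).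
- by near=> t; rewrite sqrte_ge0/=; exact: le_K.
- exact: cvg_cst.
- apply: cvg_EFin; first by near=> t.
  have -> : 0 = Num.sqrt (K * 0) :> R by rewrite mulr0 sqrtr0.
  apply: continuous_cvg; first exact: sqrt_continuous.
  by apply: cvgM => //; exact: cvg_cst.
Unshelve. all: by end_near. Qed.
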